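(* Let $\|\cdot\|_X$ and $\|\cdot\|_Y$ be normalized norms defined on $\mathbb R^2$, with unit spheres $S_X$ and $S_Y$, and let $\tau:S_X\to S_Y$ be an isometry such that $\tau(1,0)=(1,0)$ and $\tau(0,1)=(0,1)$. Then $\tau$ is the restriction of a linear isometry $(\mathbb R^2,\|\cdot\|_X)\to(\mathbb R^2,\|\cdot\|_Y)$ if and only if $S_X=S_Y$.
   Context: A norm on $\mathbb R^2$ is normalized if $\|(1,0)\|=\|(0,1)\|=1$. $S_X=\{x\in\mathbb R^2:\|x\|_X=1\}$, $S_Y=\{x\in\mathbb R^2:\|x\|_Y=1\}$, and an isometry $\tau:S_X\to S_Y$ is a map with $\|\tau(x)-\tau(x')\|_Y=\|x-x'\|_X$ for all $x,x'\in S_X$. *)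

(* Defs.v *)
From HB Require Import structures.
From mathcomp Require Import all_boot all_order all_algebra.
From mathcomp Require Import boolp classical_sets functions reals.

Set Implicit Arguments.
Unset Strict Implicit.
Unset Printing Implicit Defensive.

Import Order.TTheory GRing.Theory Num.Theory.

Local Open Scope classical_set_scope.
Local Open Scope ring_scope.

(* Norms are plain functions rather than instances of normedZmodType: two of
   them live on the same space, which already carries a canonical norm. *)
Record is_norm (R : realType) (V : lmodType R) (N : V -> R) : Prop := IsNorm {
  is_norm_ge0 : forall x, 0 <= N x;
  is_norm_eq0 : forall x, N x = 0 -> x = 0;
  is_normZ : forall (a : R) x, N (a *: x) = `|a| * N x;
  is_normD : forall x y, N (x + y) <= N x + N y
}.

Definition e1 (R : realType) : 'rV[R]_2 := delta_mx 0 0.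
Definition e2 (R : realType) : 'rV[R]_2 := delta_mx 0 1.
Arguments e1 {R}.
Arguments e2 {R}.

Definition normalized_norm (R : realType) (N : 'rV[R]_2 -> R) : Prop :=
  [/\ is_norm N, N e1 = 1 & N e2 = 1].

Definition unit_sphere (R : realType) (N : 'rV[R]_2 -> R) : set 'rV[R]_2 :=
  [set x | N x = 1].

(* Surjectivity is not required. *)
Definition isometry_on (R : realType) (A : set 'rV[R]_2)
    (NX NY : 'rV[R]_2 -> R) (f : 'rV[R]_2 -> 'rV[R]_2) : Prop :=
  forall x x', A x -> A x' -> NY (f x - f x') = NX (x - x').

(* Main.v *)
(* If S_X = S_Y the two norms coincide, and it remains to see that an isometry
   tau of the sphere S into itself fixing e1 and e2 is the identity. Removing
   the fixed point e1 turns S into a line and tau into a continuous injection h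
   of the line, hence a strictly monotone one. Along an orbit of tau consecutive
   points are at constant distance; along a monotone sequence of the line the
   points of S converge (possibly to e1), so this distance must be 0, whence
   h = id when h is increasing. If h were decreasing, tau would swap the two
   arcs of S joining e1 to e2, and x |-> tau (- x) would map the short arc
   strictly inside itself, reversing it; the orbits of its square contradict the
   same convergence argument. *)
Require Import Defs.
From HB Require Import structures.
From mathcomp Require Import all_boot all_order all_algebra.
From mathcomp Require Import boolp classical_sets functions reals.
From mathcomp Require Import topology normedtype sequences realfun derive.
From mathcomp Require Import ring lra.

Import Order.TTheory GRing.Theory Num.Theory.
Import numFieldNormedType.Exports.

Local Open Scope classical_set_scope.
Local Open Scope ring_scope.

(** * Elementary inequalities for a norm given as a function *)

Section NormTheory.
Context {R : realType} {V : lmodType R} {N : V -> R} (hN : is_norm N).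

Lemma is_norm0 : N 0 = 0.
Proof. by rewrite -(scale0r (0 : V)) (is_normZ hN) normr0 mul0r. Qed.

Lemma is_normN x : N (- x) = N x.
Proof. by rewrite -scaleN1r (is_normZ hN) normrN1 mul1r. Qed.

Lemma is_norm_distC x y : N (x - y) = N (y - x).
Proof. by rewrite -opprB is_normN. Qed.

Lemma is_norm_triangle z x y : N (x - y) <= N (x - z) + N (z - y).
Proof. by rewrite -(subrKA z x (- y)); apply: (is_normD hN). Qed.

Lemma is_norm_dist x y : `|N x - N y| <= N (x - y).
Proof.
have h u v : N u - N v <= N (u - v).
  by rewrite lerBlDr -{1}(subrK v u); apply: (is_normD hN).
by rewrite ler_norml h andbT lerNl opprB is_norm_distC.
Qed.

End NormTheory.

(** * Points of a curve along a monotone sequence of parameters *)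

Section MonotoneGap.
Context {R : realType} {V : lmodType R} {N : V -> R} (hN : is_norm N).
Context {F : R -> V} {p : V}.
Hypothesis F_cont : forall t, N (F s - F t) @[s --> t] --> (0 : R).
Hypothesis F_infty :
  forall e, 0 < e -> exists M, forall t, M <= `|t| -> N (F t - p) < e.

(** Either [u] converges and continuity gives the limit [G (limn u)], or [u] tends to infinity and
    the limit is [p]. The curve [G] is arbitrary so that a nonincreasing [u] can be handled through
    [F \o -%R]. *)
Lemma nondecreasing_seq_cvg (G : R -> V) (u : R^nat) :
  (forall t, N (G s - G t) @[s --> t] --> (0 : R)) ->
  (forall e, 0 < e -> exists M, forall t, M <= `|t| -> N (G t - p) < e) ->
  nondecreasing_seq u ->
  exists q, forall e, 0 < e -> \forall n \near \oo, N (G (u n) - q) < e.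
Proof.
move=> Gc Gi nu; have [cu|du] := pselect (cvgn u).
  exists (G (limn u)) => e e0.
  have /cvgrPdist_lt/(_ e e0) h := cvg_comp _ _ cu (Gc (limn u)).
  apply: filterS h => n /=; rewrite sub0r normrN.
  exact: le_lt_trans (ler_norm _).
exists p => e e0; have [M hM] := Gi e e0.
have /cvgryPge/(_ M) h := nondecreasing_dvgn_lt nu du.
by apply: filterS h => n Mu; apply: hM; exact: le_trans Mu (ler_norm _).
Qed.

(** Both ends of a late gap lie close to a common limit [q]; were the constant gap positive, taking
    them within half of it would contradict the triangle inequality. *)
Lemma monotone_seq_const_gap (u : R^nat) :
  nondecreasing_seq u \/ nonincreasing_seq u ->
  (forall n, N (F (u n.+2) - F (u n.+1)) = N (F (u n.+1) - F (u n))) ->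
  F (u 1%N) = F (u 0%N).
Proof.
move=> mu hu.
have [q hq] : exists q, forall e, 0 < e ->
    \forall n \near \oo, N (F (u n) - q) < e.
  case: mu => mu; first exact: nondecreasing_seq_cvg.
  have [||n m nm|q hq] := @nondecreasing_seq_cvg (F \o -%R) (-%R \o u).
  - move=> t /=.
    have Nt : (fun s : R => - s) s @[s --> t] --> - t by exact: opp_continuous.
    exact: cvg_comp Nt (F_cont (- t)).
  - move=> e /F_infty[M hM]; exists M => t; rewrite -normrN; exact: hM.
  - by rewrite /= lerN2; exact: mu.
  - by exists q => e /hq; apply: filterS => n /=; rewrite opprK.
have const n : N (F (u n.+1) - F (u n)) = N (F (u 1%N) - F (u 0%N)).
  by elim: n => // n <-.
apply/subr0_eq/(is_norm_eq0 hN)/eqP; rewrite -[_ == 0]negbK; apply/negP => Nn0.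
have e0 : 0 < N (F (u 1%N) - F (u 0%N)) / 2.
  by rewrite divr_gt0// lt_neqAle eq_sym Nn0 (is_norm_ge0 hN).
have [n _ hn] := hq _ e0.
have h1 := hn n (leqnn n); have h2 := hn n.+1 (leqnSn n).
have := is_norm_triangle hN q (F (u n.+1)) (F (u n)).
rewrite const (is_norm_distC hN q) /= in h1 h2 *.
lra.
Qed.

End MonotoneGap.

(** * Coordinates and stereographic projection of directions *)

Section Plane.
Context {R : realType}.
Implicit Types (x y : 'rV[R]_2) (a b s t : R).

Lemma rV2E x : x = x 0 0 *: e1 + x 0 1 *: e2.
Proof.
apply/rowP => i; rewrite !mxE !eqxx /=.
by case: i => [[|[|//]]] p /=; rewrite ?mulr1 ?mulr0 ?addr0 ?add0r;
  congr (x _ _); apply/val_inj.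
Qed.

Lemma coord0 a b : (a *: e1 + b *: e2 : 'rV[R]_2) 0 0 = a.
Proof. by rewrite !mxE /= mulr1 mulr0 addr0. Qed.

Lemma coord1 a b : (a *: e1 + b *: e2 : 'rV[R]_2) 0 1 = b.
Proof. by rewrite !mxE /= mulr1 mulr0 add0r. Qed.

(* Stereographic parametrization from [e1]: the ray through [dir t] runs once
   over all rays but that of [e1]. *)
Definition dir t : 'rV[R]_2 := (t ^+ 2 - 1) *: e1 + (2 * t) *: e2.

(** The cotangent of half the polar angle of [(a, b)]; the denominator vanishes exactly on the
    closed ray of [e1]. *)
Definition stereo a b : R := b / (Num.sqrt (a ^+ 2 + b ^+ 2) - a).

Lemma sqrt_sqrD_gt a b : ~ (0 <= a /\ b = 0) ->
  0 < Num.sqrt (a ^+ 2 + b ^+ 2) - a.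
Proof.
move=> ab; rewrite subr_gt0; have [a0|a0] := leP 0 a; last first.
  by rewrite (lt_le_trans a0)// sqrtr_ge0.
have b0 : 0 < b ^+ 2.
  by rewrite exprn_even_gt0//=; apply/eqP => b0; apply: ab.
by rewrite -{1}(ger0_norm a0) -sqrtr_sqr ltr_sqrt ?ltrDl// ltr_wpDl// sqr_ge0.
Qed.

Lemma stereo_dir r t : 0 < r -> stereo (r * (t ^+ 2 - 1)) (r * (2 * t)) = t.
Proof.
move=> r0; rewrite /stereo.
have -> : (r * (t ^+ 2 - 1)) ^+ 2 + (r * (2 * t)) ^+ 2 = (r * (t ^+ 2 + 1)) ^+ 2.
  by ring.
have t1 : 0 < t ^+ 2 + 1 by rewrite ltr_wpDl// sqr_ge0.
rewrite sqrtr_sqr ger0_norm ?mulr_ge0 ?ltW//.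
have -> : r * (t ^+ 2 + 1) - r * (t ^+ 2 - 1) = r * 2 by ring.
by field; rewrite gt_eqF.
Qed.

Lemma dir_stereo a b : ~ (0 <= a /\ b = 0) ->
  exists2 r, 0 < r & dir (stereo a b) = r *: (a *: e1 + b *: e2).
Proof.
move=> /sqrt_sqrD_gt; rewrite /dir /stereo.
have := sqr_sqrtr (addr_ge0 (sqr_ge0 a) (sqr_ge0 b)).
(* The second coordinate forces this factor; the first agrees because
   [b ^+ 2 - (r - a) ^+ 2 = 2 * a * (r - a)]. *)
set r := Num.sqrt _ => rE ra0; exists (2 / (r - a)); first by rewrite divr_gt0.
have ra : r - a != 0 by rewrite gt_eqF.
rewrite scalerDr !scalerA; congr (_ *: _ + _ *: _); last by field.
have -> : (b / (r - a)) ^+ 2 - 1 = (b ^+ 2 - (r - a) ^+ 2) / (r - a) ^+ 2.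
  by field.
have -> : b ^+ 2 = r ^+ 2 - a ^+ 2 by rewrite rE; ring.
by field.
Qed.

End Plane.

(** * Comparison of a normalized norm with the coordinates *)

Section PlaneNorm.
Context {R : realType} {N : 'rV[R]_2 -> R} (hN : normalized_norm N).
Implicit Types (x y : 'rV[R]_2) (a b s t : R).

Let nN : is_norm N. Proof. by case: hN. Qed.
Let N1 : N e1 = 1. Proof. by case: hN. Qed.
Let N2 : N e2 = 1. Proof. by case: hN. Qed.

Lemma norm_le_coord x : N x <= `|x 0 0| + `|x 0 1|.
Proof.
rewrite {1}(rV2E x) (le_trans (is_normD nN _ _))//.
by rewrite !(is_normZ nN) N1 N2 !mulr1.
Qed.

Lemma e2_line_gt0 : exists2 d, 0 < d & forall t, d <= N (e2 + t *: e1).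
Proof.
pose f t := N (e2 + t *: e1).
have fc : continuous f.
  move=> t; apply/cvgrPdist_lt => e e0; near=> s.
  apply: (le_lt_trans (is_norm_dist nN _ _)).
  rewrite opprD addrACA subrr add0r -scalerBl (is_normZ nN) N1 mulr1.
  by near: s; exact: (@cvgr_dist_lt _ _ _ (nbhs t) _ id t).
(* Compactness is used on [[-2, 2]] only: beyond it the reverse triangle inequality gives at least
   [|t| - 1 > 1]. *)
have m22 : -2 <= 2 :> R by lra.
have [c _ hc] := EVT_min m22 (continuous_subspaceT fc).
have fc0 : 0 < f c.
  rewrite lt_neqAle (is_norm_ge0 nN) andbT eq_sym; apply/eqP.
  move=> /(is_norm_eq0 nN)/(congr1 (fun x : 'rV_2 => x 0 1)).
  rewrite addrC -[e2]scale1r coord1 mxE => /eqP; by rewrite oner_eq0.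
exists (Num.min (f c) 1); first by rewrite lt_min fc0 ltr01.
move=> t; rewrite ge_min; apply/orP.
have [t2|t2] := leP `|t| 2.
  by left; apply: hc; rewrite in_itv/= -ler_norml.
right; have := is_norm_dist nN (t *: e1) (- e2).
rewrite opprK (is_normN nN) (is_normZ nN) N1 N2 mulr1 [_ + e2]addrC => h.
have := ler_norm (`|t| - 1); lra.
Unshelve. all: by end_near. Qed.

(** The second coordinate is bounded by rescaling [x] onto the line [e2 + t *: e1], which stays at
    distance [d] from 0; the first follows by the triangle inequality. *)
Lemma coord_le_norm : exists2 c, 0 < c &
  forall x, `|x 0 0| <= c * N x /\ `|x 0 1| <= c * N x.
Proof.
have [d d0 hd] := e2_line_gt0.
have hb x : `|x 0 1| <= d^-1 * N x.
  rewrite ler_pdivlMl//; have [->|b0] := eqVneq (x 0 1) 0.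
    by rewrite normr0 mulr0 (is_norm_ge0 nN).
  have -> : x = x 0 1 *: (e2 + (x 0 0 / x 0 1) *: e1).
    by rewrite scalerDr scalerA mulrCA divff// mulr1 addrC -rV2E.
  rewrite (is_normZ nN) mulrC.
  rewrite [X in `|X| * d]mxE.
  have -> : (e2 + (x 0 0 / x 0 1) *: e1 : 'rV[R]_2) 0 1 = 1.
    by rewrite addrC -[e2]scale1r coord1.
  by rewrite mulr1 ler_wpM2l.
exists (1 + d^-1); first by rewrite addr_gt0 ?invr_gt0.
move=> x; split; rewrite mulrDl mul1r; last first.
  by rewrite (le_trans (hb x))// lerDr (is_norm_ge0 nN).
have := is_normD nN x (- (x 0 1 *: e2)).
rewrite (is_normN nN) (is_normZ nN) N2 {1}(rV2E x) addrK (is_normZ nN) N1 !mulr1.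
by move=> h; apply: (le_trans h); rewrite lerD2l hb.
Qed.

Lemma cvg_norm_coord {T} {G : set_system T} {FG : Filter G} (F : T -> 'rV[R]_2) x :
  N (F s - x) @[s --> G] --> (0 : R) <->
  (F s 0 0 @[s --> G] --> x 0 0) /\ (F s 0 1 @[s --> G] --> x 0 1).
Proof.
split=> [h|[h0 h1]].
  have [c c0 hc] := coord_le_norm.
  have hF e : 0 < e -> \forall s \near G, c * N (x - F s) < e.
    move=> e0; have /cvgrPdist_lt/(_ (e / c)) := h.
    rewrite divr_gt0// => /(_ isT); apply: filterS => s.
    rewrite sub0r normrN ger0_norm ?(is_norm_ge0 nN)// ltr_pdivlMr// mulrC.
    by rewrite (is_norm_distC nN).
  split; apply/cvgrPdist_lt => e /hF; apply: filterS => s; apply: le_lt_trans;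
    by have [] := hc (x - F s); rewrite !mxE.
apply/cvgrPdist_lt => e e0; have e20 : 0 < e / 2 by rewrite divr_gt0.
move/cvgrPdist_lt/(_ _ e20): h0; move/cvgrPdist_lt/(_ _ e20): h1.
apply: filterS2 => s h1 h0.
rewrite sub0r normrN ger0_norm ?(is_norm_ge0 nN)// (is_norm_distC nN).
by rewrite (le_lt_trans (norm_le_coord _))// !mxE [ltRHS]splitr ltrD.
Qed.

(** * Parametrization of the unit sphere without [e1] by the line *)

Definition sphere_pt t : 'rV[R]_2 := (N (dir t))^-1 *: dir t.

Lemma norm_dir_gt0 t : 0 < N (dir t).
Proof.
rewrite lt_neqAle (is_norm_ge0 nN) andbT eq_sym; apply/eqP => /(is_norm_eq0 nN) h.
have h0 := congr1 (fun x : 'rV_2 => x 0 0) h.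
have h1 := congr1 (fun x : 'rV_2 => x 0 1) h.
rewrite /dir coord0 coord1 !mxE in h0 h1; clear h; nra.
Qed.

Lemma norm_sphere_pt t : N (sphere_pt t) = 1.
Proof.
have d0 := norm_dir_gt0 t.
by rewrite (is_normZ nN) ger0_norm ?invr_ge0 ?ltW// mulVf// gt_eqF.
Qed.

Definition sphere_coord x : R := stereo (x 0 0) (x 0 1).

Lemma sphere_ptK : cancel sphere_pt sphere_coord.
Proof.
move=> t; rewrite /sphere_coord /sphere_pt /dir !scalerDr !scalerA coord0 coord1.
by rewrite stereo_dir// invr_gt0 norm_dir_gt0.
Qed.

Lemma not_e1_coord x : N x = 1 -> x <> e1 -> ~ (0 <= x 0 0 /\ x 0 1 = 0).
Proof.
move=> Nx xe1 [x0 x1]; apply: xe1; move: Nx.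
rewrite (rV2E x) x1 scale0r addr0 (is_normZ nN) N1 mulr1 ger0_norm// => ->.
by rewrite scale1r.
Qed.

Lemma sphere_coordK x : N x = 1 -> x <> e1 -> sphere_pt (sphere_coord x) = x.
Proof.
move=> Nx xe1; have [r r0] := dir_stereo _ _ (not_e1_coord _ Nx xe1).
rewrite /sphere_pt /sphere_coord => ->; rewrite -rV2E.
by rewrite (is_normZ nN) Nx mulr1 gtr0_norm// scalerA mulVf ?gt_eqF// scale1r.
Qed.

Lemma sphere_pt_neq_e1 t : sphere_pt t <> e1.
Proof.
rewrite /sphere_pt /dir scalerDr !scalerA => h.
have h0 := congr1 (fun x : 'rV_2 => x 0 0) h.
have h1 := congr1 (fun x : 'rV_2 => x 0 1) h.
rewrite coord0 mxE /= in h0; rewrite coord1 mxE /= in h1.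
have := norm_dir_gt0 t; rewrite -invr_gt0; clear h; nra.
Qed.

Lemma sphere_pt_cvg t : N (sphere_pt s - sphere_pt t) @[s --> t] --> (0 : R).
Proof.
have d0 := norm_dir_gt0 t.
have c1 : (fun s => s ^+ 2 - 1) s @[s --> t] --> t ^+ 2 - 1.
  by apply: cvgB; [exact: exprn_continuous | exact: cvg_cst].
have c2 : (fun s => 2 * s) s @[s --> t] --> 2 * t.
  by apply: cvgM; [exact: cvg_cst | exact: cvg_id].
have cN : (fun s => (N (dir s))^-1) s @[s --> t] --> (N (dir t))^-1.
  apply: cvgV; first by rewrite gt_eqF.
  apply/cvgrPdist_lt => e e0.
  have /cvg_norm_coord : (fun s => dir s 0 0) s @[s --> t] --> dir t 0 0 /\
      (fun s => dir s 0 1) s @[s --> t] --> dir t 0 1.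
    by rewrite /dir coord0 coord1; split;
      under eq_fun do rewrite ?coord0 ?coord1.
  move=> /cvgrPdist_lt/(_ e e0); apply: filterS => s.
  rewrite sub0r normrN ger0_norm ?(is_norm_ge0 nN)//; apply: le_lt_trans.
  by rewrite distrC (is_norm_dist nN).
apply/cvg_norm_coord; rewrite /sphere_pt /dir.
split; rewrite !scalerDr !scalerA ?coord0 ?coord1;
  under eq_fun do rewrite /dir !scalerDr !scalerA ?coord0 ?coord1;
  exact: cvgM.
Qed.

Lemma sphere_pt_infty e : 0 < e ->
  exists M, forall t, M <= `|t| -> N (sphere_pt t - e1) < e.
Proof.
(* The Euclidean unit vector [v] along [dir t] is within [4 / |t|] of [e1], and normalizing it for
   [N] moves it by [|N e1 - N v|], at most as much again. The summand 1 makes the bound strict and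
   [|t| >= 1]. *)
move=> e0; exists (8 / e + 1) => t Mt.
have e8 : 0 < 8 / e by rewrite divr_gt0.
have t1 : 1 <= `|t| by lra.
pose q := t ^+ 2 + 1; have q0 : 0 < q by rewrite ltr_wpDl// sqr_ge0.
pose v := q^-1 *: dir t.
have hv : N (v - e1) <= 4 / `|t|.
  have -> : v - e1 = (- 2 / q) *: e1 + (2 * t / q) *: e2.
    rewrite [LHS]rV2E /v /dir !mxE /=.
    by congr (_ *: _ + _ *: _); rewrite /q; field; rewrite gt_eqF.
  apply: (le_trans (norm_le_coord _)); rewrite coord0 coord1 !normrM normrN.
  rewrite normfV (gtr0_norm q0) !(ger0_norm (ler0n _ 2)) -mulrDl.
  rewrite ler_pdivrMr// mulrAC ler_pdivlMr ?(lt_le_trans ltr01)//.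
  by rewrite /q -real_normK ?num_real//; nra.
have Nv : N v != 0.
  by rewrite (is_normZ nN) mulf_neq0// gt_eqF ?norm_dir_gt0//
    normr_gt0 invr_eq0 gt_eqF.
have -> : sphere_pt t = (N v)^-1 *: v.
  rewrite /v (is_normZ nN) gtr0_norm ?invr_gt0// /sphere_pt scalerA.
  by congr (_ *: _); field; rewrite !gt_eqF ?norm_dir_gt0.
have h1 : N ((N v)^-1 *: v - v) <= N (v - e1).
  rewrite -{3}[v]scale1r -scalerBl (is_normZ nN).
  have -> : `|(N v)^-1 - 1| * N v = `|N e1 - N v|.
    rewrite -{2}(ger0_norm (is_norm_ge0 nN v)) -normrM N1; congr `|_|.
    by field.
  by rewrite distrC (is_norm_dist nN).
have := is_norm_triangle nN v ((N v)^-1 *: v) e1.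
have : 8 / `|t| < e.
  rewrite ltr_pdivrMr ?(lt_le_trans ltr01)// mulrC -ltr_pdivrMr//; lra.
have -> : 8 / `|t| = 4 / `|t| + 4 / `|t| by rewrite -mulrDl; congr (_ / _); ring.
lra.
Qed.

(** The parameter 0 is that of [- e1], whose antipode [e1] has no parameter. *)
Lemma sphere_pt_opp t : t != 0 -> sphere_pt (- t^-1) = - sphere_pt t.
Proof.
move=> t0.
have hd : dir (- t^-1) = - (t ^- 2) *: dir t.
  by rewrite /dir scalerDr !scalerA; congr (_ *: _ + _ *: _); field.
have t2 : 0 < t ^- 2 by rewrite invr_gt0 exprn_even_gt0.
rewrite /sphere_pt hd (is_normZ nN) normrN gtr0_norm// scalerA mulrN scaleNr.
by congr (- (_ *: _)); field; rewrite t0 gt_eqF ?norm_dir_gt0.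
Qed.

Lemma sphere_pt1 : sphere_pt 1 = e2.
Proof.
have h : dir (1 : R) = 2 *: e2 by rewrite /dir expr1n subrr scale0r add0r mulr1.
rewrite /sphere_pt h (is_normZ nN) N2 mulr1 ger0_norm ?ler0n//.
by rewrite scalerA mulVf ?scale1r// pnatr_eq0.
Qed.

(** * Isometries of the sphere into itself fixing [e1] and [e2] *)

Section FixingIsometry.
Context (tau : 'rV[R]_2 -> 'rV[R]_2).
Hypothesis tau_sphere : forall x, N x = 1 -> N (tau x) = 1.
Hypothesis tau_iso : isometry_on (unit_sphere N) N N tau.
Hypothesis tau_e1 : tau e1 = e1.
Hypothesis tau_e2 : tau e2 = e2.

Let h t := sphere_coord (tau (sphere_pt t)).

Lemma isometry_inj x y : N x = 1 -> N y = 1 -> tau x = tau y -> x = y.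
Proof.
move=> Nx Ny xy; apply/subr0_eq/(is_norm_eq0 nN).
by rewrite -tau_iso// xy subrr (is_norm0 nN).
Qed.

(** Being injective and fixing [e1], [tau] never takes the value [e1] elsewhere, so [sphere_coord]
    is inverted here. *)
Lemma sphere_pt_induced t : sphere_pt (h t) = tau (sphere_pt t).
Proof.
have Nt := norm_sphere_pt t.
apply: sphere_coordK; first exact: tau_sphere.
by rewrite -[RHS]tau_e1 => /(isometry_inj _ _ Nt N1); exact: sphere_pt_neq_e1.
Qed.

Lemma induced_inj : injective h.
Proof.
move=> s t /(congr1 sphere_pt); rewrite !sphere_pt_induced => st.
apply: (can_inj sphere_ptK); apply: isometry_inj st; exact: norm_sphere_pt.
Qed.

Lemma induced_continuous : continuous h.
Proof.
move=> t.
have /cvg_norm_coord[c0 c1] :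
    N (tau (sphere_pt s) - tau (sphere_pt t)) @[s --> t] --> (0 : R).
  have -> : (fun s => N (tau (sphere_pt s) - tau (sphere_pt t))) =
      (fun s => N (sphere_pt s - sphere_pt t)).
    by apply/funext => s; apply: tau_iso; exact: norm_sphere_pt.
  exact: sphere_pt_cvg.
rewrite /h /sphere_coord /stereo.
apply: cvgM; first exact: c1.
have Nt := norm_sphere_pt t.
have ne1 : tau (sphere_pt t) <> e1.
  by rewrite -sphere_pt_induced; exact: sphere_pt_neq_e1.
apply: cvgV.
  by rewrite gt_eqF// sqrt_sqrD_gt//; apply: not_e1_coord => //; exact: tau_sphere.
apply: cvgB; last exact: c0.
apply: continuous_cvg; first exact: sqrt_continuous.
by apply: cvgD; apply: cvgM.
Qed.

Lemma induced_monotone : {homo h : s t / s < t} \/ {homo h : s t /~ s < t}.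
Proof.
have [] := @itv_continuous_inj_mono R h `]-oo, +oo[.
- exact/continuous_subspaceT/induced_continuous.
- by move=> s t _ _; exact: induced_inj.
- by move=> m; left => s t; apply: m; rewrite in_itv.
- by move=> m; right => s t; apply: m; rewrite in_itv.
Qed.

(** The orbit of [t] rises or falls according to the sign of [h t - t]; its gaps are constant since
    [tau] is an isometry, so the first one is zero. *)
Lemma increasing_induced_id : {homo h : s t / s < t} -> forall t, h t = t.
Proof.
move=> /ltW_homo hm t; apply: (can_inj sphere_ptK).
pose u n := iter n h t.
apply: (monotone_seq_const_gap nN sphere_pt_cvg sphere_pt_infty u).
  have [tt|tt] := leP t (h t); [left|right].
    by apply/nondecreasing_seqP; elim=> //= n; exact: hm.
  by apply/nonincreasing_seqP; elim=> /= [|n]; [exact: ltW | exact: hm].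
have uE m : sphere_pt (u m.+1) = tau (sphere_pt (u m)).
  exact: sphere_pt_induced.
move=> n; rewrite (uE n.+1) -[RHS]tau_iso -?(uE n)//; exact: norm_sphere_pt.
Qed.

(* The short arc is [t >= 1], and [t |-> - t^-1] is the antipodal map. *)
Lemma not_decreasing_induced : ~ {homo h : s t /~ s < t}.
Proof.
move=> hm.
have h1 : h 1 = 1 by rewrite /h sphere_pt1 tau_e2 -sphere_pt1 sphere_ptK.
(* The map sending [x] to [tau (- x)], read in the parameter. On [[1, +oo[] it is antitone with
   values above 1, since [- t^-1 < 1] and [h] reverses order and fixes 1. *)
pose k t := h (- t^-1).
have k1 t : 1 <= t -> 1 < k t.
  move=> t1; rewrite -[ltLHS]h1; apply: hm.
  by rewrite (lt_trans _ ltr01)// oppr_lt0 invr_gt0 (lt_le_trans ltr01).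
have km s t : 1 <= s -> s <= t -> k t <= k s.
  move=> s1; rewrite le_eqVlt => /predU1P[->//|st].
  apply/ltW/hm; rewrite ltrN2 ltf_pV2// posrE (lt_le_trans ltr01)//.
  exact: le_trans (ltW st).
have kE t : 1 <= t -> sphere_pt (k t) = tau (- sphere_pt t).
  move=> t1; rewrite sphere_pt_induced sphere_pt_opp// gt_eqF//.
  exact: lt_le_trans t1.
have kd s t : 1 <= s -> 1 <= t ->
    N (sphere_pt (k s) - sphere_pt (k t)) = N (sphere_pt s - sphere_pt t).
  move=> s1 t1; rewrite !kE// tau_iso.
  - by rewrite -opprD (is_normN nN).
  - by rewrite /unit_sphere/= (is_normN nN) norm_sphere_pt.
  - by rewrite /unit_sphere/= (is_normN nN) norm_sphere_pt.
pose u n := iter n (k \o k) 1.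
have u1 n : 1 <= u n.
  by elim: n => //= n /k1/ltW/k1/ltW.
have ku1 n := ltW (k1 _ (u1 n)).
have gap n : N (sphere_pt (u n.+2) - sphere_pt (u n.+1)) =
    N (sphere_pt (u n.+1) - sphere_pt (u n)).
  exact: etrans (kd _ _ (ku1 n.+1) (ku1 n)) (kd _ _ (u1 n.+1) (u1 n)).
(* The square of the antitone [k] preserves order, and the orbit starts at the least parameter 1. *)
have nd : nondecreasing_seq u.
  apply/nondecreasing_seqP; elim=> [|n un]; first exact: (u1 1%N).
  exact: (km _ _ (ku1 n.+1) (km _ _ (u1 n) un)).
(* A zero gap forces [k (k 1) = 1], whereas [k] takes values above 1. *)
have /(can_inj sphere_ptK) kk :=
  monotone_seq_const_gap nN sphere_pt_cvg sphere_pt_infty u (or_introl nd) gap.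
by have := k1 _ (ku1 0%N); rewrite -[ltRHS]/(u 1%N) kk ltxx.
Qed.

Lemma isometry_fixing_basis_id x : N x = 1 -> tau x = x.
Proof.
move=> Nx; have [->//|/eqP xe1] := eqVneq x e1.
rewrite -(sphere_coordK _ Nx xe1) -sphere_pt_induced.
by case: induced_monotone => [/increasing_induced_id->|/not_decreasing_induced].
Qed.

End FixingIsometry.

End PlaneNorm.

(** * Norms with the same unit sphere, and the equivalence *)

Lemma is_norm_unit_sphere_inj (R : realType) (V : lmodType R) (N M : V -> R) :
  is_norm N -> is_norm M -> (forall x, N x = 1 -> M x = 1) -> N =1 M.
Proof.
move=> nN nM NM x; have [->|x0] := eqVneq x 0; first by rewrite !is_norm0.
have Nx : N x != 0 by apply: contra_neq x0; exact: is_norm_eq0.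
have Nx0 : 0 < N x by rewrite lt_neqAle eq_sym Nx (is_norm_ge0 nN).
(* One inclusion of spheres suffices: [x] is rescaled to [N]-norm 1, and homogeneity of [M] recovers
   [M x]. *)
have := NM ((N x)^-1 *: x).
rewrite (is_normZ nN) (is_normZ nM) gtr0_norm ?invr_gt0// mulVf// => /(_ erefl).
by move/(congr1 ( *%R (N x))); rewrite mulrA mulfV// mul1r mulr1.
Qed.

Theorem theorem2p3 (R : realType) (NX NY : 'rV[R]_2 -> R)
    (hX : normalized_norm NX) (hY : normalized_norm NY)
    (tau : {fun unit_sphere NX >-> unit_sphere NY})
    (tau_iso : isometry_on (unit_sphere NX) NX NY tau)
    (tau_e1 : tau e1 = e1) (tau_e2 : tau e2 = e2) :
  (exists T : {linear 'rV[R]_2 -> 'rV[R]_2},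
      isometry_on [set: 'rV[R]_2] NX NY T
      /\ forall x, unit_sphere NX x -> tau x = T x)
  <-> unit_sphere NX = unit_sphere NY.
Proof.
have [nX X1 X2] := hX; have [nY _ _] := hY; split=> [[T [Tiso tauT]]|XY].
  (* A linear map fixing both basis vectors is the identity, so its being an isometry equates the
     norms. *)
  have T1 : T e1 = e1 by rewrite -tauT.
  have T2 : T e2 = e2 by rewrite -tauT.
  have Tid x : T x = x by rewrite {1}(rV2E x) linearD !linearZ /= T1 T2 -rV2E.
  suff NXY x : NY x = NX x by apply/seteqP; split=> x; rewrite /unit_sphere /= NXY.
  by have := Tiso x 0 I I; rewrite !Tid subr0.
have NXY : NX = NY.
  apply/funext/is_norm_unit_sphere_inj => // x Nx.
  by have : unit_sphere NY x by rewrite -XY.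
(* With equal norms, [tau] is an isometry of one sphere into itself fixing [e1] and [e2], so the
   linear extension can only be the identity. *)
exists idfun; split=> [x y _ _|x Nx] /=; first by rewrite NXY.
apply: (isometry_fixing_basis_id hX) => //.
- move=> y Ny; have tauy : NY (tau y) = 1 by exact: (@funS _ _ _ _ tau).
  exact: etrans (congr1 (@^~ (tau y)) NXY) tauy.
- move=> y z Ny Nz.
  exact: etrans (congr1 (@^~ (tau y - tau z)) NXY) (tau_iso y z Ny Nz).
Qed.
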